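(* For a positive integer $n$, let $q_{eu}^{ou}(n)$ be the number of partitions of $n$ with no part equal to $1$ in which every even part is strictly less than every odd part (partitions with all parts even or all parts odd are included). Let $q_{ou}^{eu}(n)$ be the number of partitions of $n$ with no part equal to $1$ in which every odd part is strictly less than every even part and which have at least one odd part (so partitions with all parts even are excluded, while partitions with all parts odd are included). Then for all $n>3$, \[ q_{ou}^{eu}(n) < q_{eu}^{ou}(n). \]
   Context: A partition of $n$ is a non-increasing sequence of positive integers summing to $n$; its entries are its parts. Equivalently, the generating functions are $\sum_{n\geq 0} q_{eu}^{ou}(n)q^n=\frac{1}{(1-q)(q^2;q^2)_\infty}-\frac{q}{(q;q^2)_\infty}$ and $\sum_{n\geq 0} q_{ou}^{eu}(n)q^n=\frac{1}{(q;q^2)_\infty}-\frac{1+q}{(q^2;q^2)_\infty}$, where $(a;q)_\infty=\prod_{k\geq 1}(1-aq^{k-1})$. *)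

(* Defs.v *)
From HB Require Import structures.
From mathcomp Require Import all_boot.
Set Implicit Arguments.
Unset Strict Implicit.
Unset Printing Implicit Defensive.

Definition is_partition (n : nat) (s : seq nat) : bool :=
  [&& sorted geq s, 0 \notin s & sumn s == n].

Record intpart (n : nat) := IntPart {
  parts :> seq nat;
  _ : is_partition n parts
}.

HB.instance Definition _ (n : nat) := [isSub for @parts n].
HB.instance Definition _ (n : nat) := [Countable of intpart n by <:].

(* Finiteness: a partition of n has at most n parts, all of them at most n,   *)
(* so intpart n embeds into the finite type {bseq n of 'I_n.+1}.              *)
Lemma size_partition (n : nat) (s : seq nat) : is_partition n s -> size s <= n.
Proof.
case/and3P=> _ s0 /eqP<-; elim: s s0 => //= x s IHs.
rewrite inE negb_or eq_sym -lt0n => /andP[x_gt0 /IHs le_s].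
by rewrite -add1n leq_add.
Qed.

Lemma partition_le (n : nat) (s : seq nat) :
  is_partition n s -> {in s, forall x, x <= n}.
Proof.
case/and3P=> _ _ /eqP<- x; elim: s => //= y s IHs.
rewrite inE => /predU1P[->|/IHs le_x]; first exact: leq_addr.
exact: leq_trans le_x (leq_addl _ _).
Qed.

Definition bseq_of_intpart (n : nat) (p : intpart n) : {bseq n of 'I_n.+1} :=
  insub_bseq n [seq inord x | x <- parts p].

Definition intpart_of_bseq (n : nat) (b : {bseq n of 'I_n.+1}) :
  option (intpart n) := insub [seq val i | i <- b].

Lemma bseq_of_intpartK (n : nat) :
  pcancel (@bseq_of_intpart n) (@intpart_of_bseq n).
Proof.
move=> p; have Pp := valP p; rewrite /intpart_of_bseq.
suff -> : [seq val i | i <- bseq_of_intpart p] = val p by rewrite valK.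
rewrite /bseq_of_intpart /insub_bseq val_insubd size_map.
rewrite (size_partition Pp) -map_comp map_id_in // => x /(partition_le Pp) le_x.
by rewrite /= inordK.
Qed.

HB.instance Definition _ (n : nat) : isFinite (intpart n) :=
  PCanIsFinite (@bseq_of_intpartK n).

Definition no_part_one (s : seq nat) : bool := 1 \notin s.

Definition evens_below_odds (s : seq nat) : bool :=
  allrel ltn [seq a <- s | ~~ odd a] [seq b <- s | odd b].

Definition odds_below_evens (s : seq nat) : bool :=
  allrel ltn [seq b <- s | odd b] [seq a <- s | ~~ odd a].

Definition q_eu_ou (n : nat) : nat :=
  #|[set p : intpart n | no_part_one p && evens_below_odds p]|.

Definition q_ou_eu (n : nat) : nat :=
  #|[set p : intpart n | [&& no_part_one p, odds_below_evens p & has odd p]]|.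

(* Main.v *)
Require Import Defs.
From mathcomp Require Import all_boot all_order all_algebra.
From mathcomp Require Import zify ring.

(* Splitting by the largest even part 2j, the partitions counted by q_eu_ou
   have series [O' + sum_(j >= 1) q^(2j) P_j], where [P_j] counts partitions
   into even parts <= 2j and odd parts > 2j, and [O' = (1 - q) P_0] those into
   odd parts > 1; splitting by the largest odd part gives a similar sum for
   q_ou_eu.  Both sums telescope after multiplication by 1 - q, and with
   [E = 1/(q^2;q^2)_oo] and [O = P_0 = 1/(q;q^2)_oo] the difference of the two
   series is [(1/(1-q) + 1 + q) E - (1 + q) O].  Gauss's identity
   [O = E * sum_t q^(t(t+1)/2)], together with the decomposition of [1/(1-q)]
   into blocks of exponents starting at the triangular numbers, turns it into
   [E * (1 + sum_(t >= 2) sum_(2 <= i <= t) q^(t(t+1)/2 + i))].  The terms 1 and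
   q^5 make every coefficient of degree > 3 positive. *)

Set Implicit Arguments.
Unset Strict Implicit.
Unset Printing Implicit Defensive.

Import GRing.Theory Num.Theory.

(** * Counting partitions with parts in a prescribed set *)

Definition parts_in (n : nat) (L : pred nat) : nat :=
  #|[set p : intpart n | all L p]|.

Lemma intpartP (n : nat) (p : intpart n) :
  [/\ sorted geq p, forall x, x \in parts p -> 0 < x <= n & sumn p = n].
Proof.
have Pp := valP p; case/and3P: (Pp) => sp p0 /eqP np; split=> // x xp.
rewrite (partition_le Pp xp) andbT lt0n.
by apply: contraNneq p0 => <-.
Qed.

Lemma eq_parts_in (n : nat) (L M : pred nat) :
  (forall x, 0 < x <= n -> L x = M x) -> parts_in n L = parts_in n M.
Proof.
move=> eqLM; apply: eq_card => p; rewrite !inE; apply: eq_in_all => x.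
by case: (intpartP p) => _ px _ /px /eqLM.
Qed.

Lemma sorted_geq_eq (s t : seq nat) :
  sorted geq s -> sorted geq t -> perm_eq s t -> s = t.
Proof.
apply: sorted_eq; first exact: rev_trans leq_trans.
by move=> x y /= /anti_leq.
Qed.

Lemma sort_geq_sorted (s : seq nat) : sorted geq (sort geq s).
Proof. by apply: sort_sorted => x y /=; rewrite leq_total. Qed.

Lemma is_partition_add (m a : nat) (p : intpart m) :
  0 < a -> is_partition (m + a) (sort geq (a :: p)).
Proof.
move=> a0; case: (intpartP p) => _ p0 sp; apply/and3P; split.
- exact: sort_geq_sorted.
- rewrite mem_sort inE negb_or eq_sym -lt0n a0 /=.
  by apply/negP => /p0.
- by rewrite (perm_sumn (permEl (perm_sort _ _))) /= sp addnC.
Qed.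

(** Inserting one copy of [a] and re-sorting is a bijection; its inverse removes one copy. *)
Lemma parts_in_mem (m a : nat) (L : pred nat) : 0 < a -> L a ->
  #|[set p : intpart (m + a) | (a \in parts p) && all L p]| = parts_in m L.
Proof.
move=> a0 La; pose f (p : intpart m) := IntPart (is_partition_add p a0).
have injf : injective f.
  move=> p p' /(congr1 (@parts _)) /= eq_s; apply/val_inj => /=.
  case: (intpartP p) (intpartP p') => sp _ _ [sp' _ _].
  apply: sorted_geq_eq => //.
  by rewrite -(perm_cons a) -(perm_sort geq) eq_s perm_sort.
rewrite /parts_in -(card_imset _ injf); apply: eq_card => p; rewrite inE.
apply/andP/imsetP => [[ap Lp]|[r]].
  case: (intpartP p) => sp p0 np.
  have pr : is_partition m (rem a p).
    apply/and3P; split.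
    - exact: (subseq_sorted (rev_trans leq_trans) (rem_subseq _ _) sp).
    - by apply/negP => /mem_rem /p0.
    - by move/perm_to_rem: ap => /perm_sumn /=; rewrite np; lia.
  exists (IntPart pr).
    by rewrite inE /=; apply/allP => x /mem_rem; apply/allP.
  apply/val_inj => /=; apply: sorted_geq_eq => //.
    exact: sort_geq_sorted.
  by rewrite perm_sym perm_sort perm_sym perm_to_rem.
rewrite inE => Lr -> /=; rewrite mem_sort mem_head; split=> //.
by rewrite all_sort /= La.
Qed.

Lemma card_intpart_mem (n a : nat) (L : pred nat) : 0 < a -> L a ->
  #|[set p : intpart n | (a \in parts p) && all L p]|
  = if a <= n then parts_in (n - a) L else 0.
Proof.
move=> a0 La; case: leqP => [/subnK <-|lt_na]; first by rewrite addnK parts_in_mem.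
apply: eq_card0 => p; rewrite inE; case: (intpartP p) => _ px _.
by apply/negP => /andP[/px]; lia.
Qed.

(** Coefficient form of deleting the factor [1/(1 - q^a)] from a product generating function. *)
Lemma parts_inD1 (n a : nat) (L : pred nat) : 0 < a -> L a ->
  parts_in n L =
  (if a <= n then parts_in (n - a) L else 0)
    + parts_in n (fun x => (x != a) && L x).
Proof.
move=> a0 La; rewrite -card_intpart_mem // /parts_in.
rewrite -(cardsID [set p : intpart n | a \in parts p]); congr (_ + _).
  by apply: eq_card => p; rewrite !inE andbC.
apply: eq_card => p; rewrite !inE all_predI; congr (_ && _).
apply/negP/allP => [ap x xp|h /h]; last by rewrite eqxx.
by apply/eqP => xa; rewrite xa in xp.
Qed.

Lemma parts_in_pred0 (n : nat) (L : pred nat) :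
  (forall x, 0 < x <= n -> L x = false) -> parts_in n L = (n == 0).
Proof.
move=> L0; rewrite (eq_parts_in (M := pred0)) //.
case: n {L0} => [|n] /=.
  have p0 : is_partition 0 [::] by [].
  apply/eqP/cards1P; exists (IntPart p0); apply/setP => p; rewrite !inE.
  apply/idP/eqP => [|-> //]; move=> h; apply/val_inj => /=.
  by case: (parts p) h.
apply: eq_card0 => p; rewrite inE; case: (intpartP p) => _ _.
by case: (parts p).
Qed.

(** * Splitting by the largest even or the largest odd part *)

(** The parts still allowed once [2j] is the largest even part. On positive integers, [j = 0] leaves
    exactly the odd ones. *)
Definition evens_le_odds_gt (j : nat) : pred nat :=
  fun x => if odd x then j.*2 < x else x <= j.*2.

(** The analogue with [2j+1] as the largest odd part. For [j = 0] the odd range is empty, which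
    leaves the positive even integers. *)
Definition odds_le_evens_gt (j : nat) : pred nat :=
  fun x => if odd x then 1 < x <= j.*2.+1 else j.*2.+1 < x.

Lemma evens_below_oddsP (s : seq nat) :
  reflect {in s &, forall a b, ~~ odd a -> odd b -> a < b} (evens_below_odds s).
Proof.
apply: (iffP allrelP) => [h a b sa sb ea ob|h a b].
  by apply: h; rewrite mem_filter ?ea ?ob.
by rewrite !mem_filter => /andP[ea sa] /andP[ob sb]; apply: h.
Qed.

Lemma odds_below_evensP (s : seq nat) :
  reflect {in s &, forall a b, odd a -> ~~ odd b -> a < b} (odds_below_evens s).
Proof.
apply: (iffP allrelP) => [h a b sa sb ea ob|h a b].
  by apply: h; rewrite mem_filter ?ea ?ob.
by rewrite !mem_filter => /andP[ea sa] /andP[ob sb]; apply: h.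
Qed.

(** Induction on a bound [2J] for the even parts: raising [J] by one adds the partitions that
    contain [2J+2], and removing one copy of it leaves a free choice from [evens_le_odds_gt]. *)
Lemma q_eu_ou_sum (n : nat) : q_eu_ou n =
  parts_in n (fun x => odd x && (1 < x)) +
  \sum_(1 <= j < n.+1)
    if j.*2 <= n then parts_in (n - j.*2) (evens_le_odds_gt j) else 0.
Proof.
pose B J := [set p : intpart n | [&& no_part_one p, evens_below_odds p
                                  & all (fun x => odd x || (x <= J.*2)) p]].
have BS J : #|B J.+1| = #|B J| +
    if J.+1.*2 <= n then parts_in (n - J.+1.*2) (evens_le_odds_gt J.+1) else 0.
  rewrite -card_intpart_mem //; last by rewrite /evens_le_odds_gt odd_double /=.
  rewrite addnC -(cardsID [set p : intpart n | J.+1.*2 \in parts p]); congr (_ + _).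
    apply: eq_card => p; rewrite !inE andbC; case: (boolP (_ \in _)) => //= Jp.
    apply/and3P/allP => [[p1 /evens_below_oddsP h /allP pJ] x xp|h].
      rewrite /evens_le_odds_gt; case: ifP => ox.
        by apply: h => //; rewrite odd_double.
      by have := pJ x xp; rewrite ox.
    split.
    - by apply/negP => /h.
    - apply/evens_below_oddsP => a b /h + /h; rewrite /evens_le_odds_gt.
      by case: (odd a); case: (odd b) => //= lea ltb _ _; apply: leq_ltn_trans ltb.
    - by apply/allP => x /h; rewrite /evens_le_odds_gt; case: odd.
  apply: eq_card => p; rewrite !inE andbC.
  case: (no_part_one p); rewrite ?andbF //; case: (evens_below_odds p); rewrite ?andbF //=.
  apply/andP/allP => [[/allP h Jp] x xp|h].
    have := h x xp; case ox: (odd x) => //= le_x.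
    by have /eqP : x != J.+1.*2 by [apply: contraNneq Jp => <-]; lia.
  split; last by apply/negP => /h; rewrite odd_double; lia.
  by apply/allP => x /h /orP[->//|]; lia.
have B0 : #|B 0| = parts_in n (fun x => odd x && (1 < x)).
  apply: eq_card => p; rewrite !inE; case: (intpartP p) => _ px _.
  apply/and3P/allP => [[p1 _ /allP h] x xp|h].
    have := h x xp; have /andP[x0 _] := px x xp; rewrite leqn0 eqn0Ngt x0 orbF.
    move=> ->; rewrite ltn_neqAle x0 andbT; by apply: contraNneq p1 => ->.
  split.
  - by apply/negP => /h.
  - by apply/evens_below_oddsP => a b /h /andP[->].
  - by apply/allP => x /h /andP[->].
have BJ J : #|B J| = #|B 0| + \sum_(1 <= j < J.+1)
    if j.*2 <= n then parts_in (n - j.*2) (evens_le_odds_gt j) else 0.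
  elim: J => [|J IH]; first by rewrite big_geq ?addn0.
  by rewrite big_nat_recr //= BS IH addnA.
rewrite -B0 -BJ; apply: eq_card => p; rewrite !inE.
suff -> : all (fun x => odd x || (x <= n.*2)) p by rewrite andbT.
apply/allP => x; case: (intpartP p) => _ px _ /px; lia.
Qed.

Lemma q_ou_eu_sum (n : nat) : q_ou_eu n =
  \sum_(1 <= j < n.+1)
    if j.*2.+1 <= n then parts_in (n - j.*2.+1) (odds_le_evens_gt j) else 0.
Proof.
pose A J := [set p : intpart n | [&& no_part_one p, odds_below_evens p, has odd p
                                  & all (fun x => ~~ odd x || (x <= J.*2.+1)) p]].
have AS J : #|A J.+1| = #|A J| +
    if J.+1.*2.+1 <= n then parts_in (n - J.+1.*2.+1) (odds_le_evens_gt J.+1) else 0.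
  rewrite -card_intpart_mem //; last by rewrite /odds_le_evens_gt /= odd_double /=.
  rewrite addnC -(cardsID [set p : intpart n | J.+1.*2.+1 \in parts p]); congr (_ + _).
    apply: eq_card => p; rewrite !inE andbC; case: (boolP (_ \in _)) => //= Jp.
    apply/and4P/allP => [[p1 /odds_below_evensP h _ /allP pJ] x xp|h].
      have := pJ x xp; rewrite /odds_le_evens_gt; case: ifP => ox /=.
        case: (intpartP p) => _ px _ ->; rewrite andbT.
        have /andP[x0 _] := px x xp; rewrite ltn_neqAle x0 andbT.
        by apply: contraNneq p1 => ->.
      by move=> _; apply: h; rewrite ?ox //= odd_double.
    split.
    - by apply/negP => /h.
    - apply/odds_below_evensP => a b /h + /h; rewrite /odds_le_evens_gt.
      by case: (odd a); case: (odd b) => //= /andP[_ lea] ltb _ _; apply: leq_ltn_trans ltb.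
    - by apply/hasP; exists J.+1.*2.+1; rewrite //= odd_double.
    - by apply/allP => x /h; rewrite /odds_le_evens_gt; case: odd => //= /andP[].
  apply: eq_card => p; rewrite !inE andbC.
  case: (no_part_one p); rewrite ?andbF //; case: (odds_below_evens p); rewrite ?andbF //=.
  case: (has odd p); rewrite ?andbF //=.
  apply/andP/allP => [[/allP h Jp] x xp|h].
    have := h x xp; case ox: (odd x) => //= le_x.
    by have /eqP : x != J.+1.*2.+1 by [apply: contraNneq Jp => <-]; lia.
  split; last by apply/negP => /h; rewrite /= odd_double; lia.
  by apply/allP => x /h /orP[->//|]; lia.
(* An odd part at most 1 would be the forbidden part 1, so no all-odd remainder appears here. *)
have A0 : #|A 0| = 0.
  apply: eq_card0 => p; rewrite inE; apply/negP => /and4P[p1 _ /hasP[x xp ox] /allP h].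
  have := h x xp; rewrite ox /=; case: (intpartP p) => _ px _.
  have /andP[x0 _] := px x xp => x1.
  by have x1' : x = 1 by [lia]; rewrite x1' in xp; rewrite /no_part_one xp in p1.
have AJ J : #|A J| = \sum_(1 <= j < J.+1)
    if j.*2.+1 <= n then parts_in (n - j.*2.+1) (odds_le_evens_gt j) else 0.
  elim: J => [|J IH]; first by rewrite big_geq.
  by rewrite big_nat_recr //= AS IH.
rewrite -AJ; apply: eq_card => p; rewrite !inE.
suff -> : all (fun x => ~~ odd x || (x <= n.*2.+1)) p by rewrite andbT.
apply/allP => x; case: (intpartP p) => _ px _ /px; lia.
Qed.

(** * Gauss's identity and the telescoping sums in a commutative ring *)

Lemma bin2_double (m : nat) : 'C(m.*2, 2) = (m * m.*2.-1).
Proof. by rewrite bin2 -doubleMl doubleK. Qed.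

Lemma bin2_doubleS (m : nat) : 'C(m.*2.+1, 2) = (m.*2.+1 * m).
Proof. by rewrite bin2 -doubleMr doubleK. Qed.

Local Open Scope ring_scope.

(* Shanks's finite form of Gauss's identity: a high power of [q] kills every
   term of the left-hand sum except [s = 0]. *)
Lemma shanks (R : comNzRingType) (q : R) (v : nat -> R) (n : nat) :
  (forall k, v k * (1 - q ^+ k.*2.+1) = 1) ->
  \sum_(0 <= s < n.+1)
     (\prod_(s <= k < n) ((1 - q ^+ k.+1.*2) * v k)) * q ^+ (s * n.*2.+1)
  = \sum_(0 <= t < n.*2.+1) q ^+ 'C(t.+1, 2).
Proof.
move=> hv; pose w s n := \prod_(s <= k < n) ((1 - q ^+ k.+1.*2) * v k).
have wS s m : (s <= m)%N -> w s m.+1 = w s m * ((1 - q ^+ m.+1.*2) * v m).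
  by move=> le_sm; rewrite /w big_nat_recr.
elim: n => [|n IH]; first by rewrite !big_nat1 big_geq // mul0n mul1r.
(* Passing from [n] to [n+1] changes each partial sum by one closed term. At [m = n] that term is
   the triangular power [q^((n+1)(2n+1))], and the summand [s = n+1] supplies the next one,
   [q^((n+1)(2n+3))]. *)
have step m : (m <= n)%N ->
    \sum_(0 <= s < m.+1) w s n.+1 * q ^+ (s * n.+1.*2.+1) =
    \sum_(0 <= s < m.+1) w s n * q ^+ (s * n.*2.+1)
      + v n * w m n * (1 - q ^+ m.*2.+1) * q ^+ (m.+1 * n.*2.+1).
  elim: m => [_|m IHm lt_mn].
    rewrite !big_nat1 wS // !mul0n mul1n !expr0 doubleS !exprS.
    have := hv n; rewrite !exprS expr0; set x := q ^+ _ => hn.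
    transitivity (w 0%N n * (v n * (1 - q * x) + v n * (1 - q * 1) * (q * x))).
      by ring.
    by rewrite hn; ring.
  rewrite big_nat_recr //= IHm 1?ltnW // [in RHS]big_nat_recr //= -!addrA.
  congr (_ + _); rewrite wS //.
  have -> : w m n = (1 - q ^+ m.+1.*2) * v m * w m.+1 n.
    by rewrite /w big_ltn.
  have -> : q ^+ (m.+1 * n.+1.*2.+1) = q ^+ (m.+1 * n.*2.+1) * q ^+ m.+1.*2.
    by rewrite -exprD; congr (_ ^+ _); lia.
  have -> : q ^+ (m.+2 * n.*2.+1) = q ^+ (m.+1 * n.*2.+1) * q ^+ n.*2.+1.
    by rewrite -exprD; congr (_ ^+ _); lia.
  have hm := hv m; have hn := hv n.
  set W := w m.+1 n; set z := q ^+ (m.+1 * _).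
  rewrite [q ^+ m.+1.*2.+1]exprS [q ^+ n.+1.*2]exprS -/(n.*2.+1).
  set x := q ^+ m.+1.*2; set y := q ^+ n.*2.+1 in hn *.
  (* The two intermediate forms expose the products that [hm] and [hn] reduce to 1. *)
  transitivity (v n * W * z * ((v m * (1 - q ^+ m.*2.+1)) * (1 - x)
    + x * (1 - q * y))); first by ring.
  transitivity (W * z * (v n * (1 - y)) + v n * W * z * (1 - q * x) * y);
    first by rewrite hm; ring.
  by rewrite hn; ring.
rewrite doubleS big_nat_recr //= (step n) // IH [in RHS]big_nat_recr //= [in RHS]big_nat_recr //=.
have wnn m : w m m = 1 by rewrite /w big_geq.
rewrite -/(w _ _) !wnn mul1r mulr1 hv mul1r.
by rewrite -(bin2_double n.+1) mulnC -[n.*2.+3]/(n.+1.*2.+1) -bin2_doubleS.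
Qed.

Lemma expr_ge_eq0 (R : pzRingType) (q : R) (m k : nat) :
  q ^+ m = 0 -> (m <= k)%N -> q ^+ k = 0.
Proof. by move=> qm /subnK <-; rewrite exprD qm mulr0. Qed.

Lemma ratio_prod (R : comNzRingType) (q : R) (v P : nat -> R) (n : nat) :
  (forall k, v k * (1 - q ^+ k.*2.+1) = 1) ->
  (forall j, P j.+1 * (1 - q ^+ j.+1.*2) = P j * (1 - q ^+ j.*2.+1)) ->
  P 0 = P n * \prod_(0 <= k < n) ((1 - q ^+ k.+1.*2) * v k).
Proof.
move=> hv hP; elim: n => [|n IH]; first by rewrite big_geq ?mulr1.
rewrite big_nat_recr //= IH.
have -> : P n = P n.+1 * (1 - q ^+ n.+1.*2) * v n.
  by rewrite hP -mulrA [_ * v n]mulrC hv mulr1.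
by ring.
Qed.

(** Block [t] has length [t+1] and ends just before the next triangular number, so the blocks tile
    the exponents below ['C(m.+1, 2)] and the sum is geometric. *)
Lemma sum_triangular_blocks (R : comNzRingType) (q : R) (m : nat) :
  (1 - q) * \sum_(0 <= t < m) \sum_(0 <= i < t.+1) q ^+ ('C(t.+1, 2) + i)
  = 1 - q ^+ 'C(m.+1, 2).
Proof.
elim: m => [|m IH]; first by rewrite big_geq // mulr0 subrr.
rewrite big_nat_recr //= mulrDr IH.
have -> : \sum_(0 <= i < m.+1) q ^+ ('C(m.+1, 2) + i) =
   q ^+ 'C(m.+1, 2) * \sum_(i < m.+1) q ^+ i.
  by rewrite mulr_sumr big_mkord; apply: eq_bigr => i _; rewrite exprD.
have -> : q ^+ 'C(m.+2, 2) = q ^+ 'C(m.+1, 2) * q ^+ m.+1.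
  by rewrite binS bin1 exprD.
have /(congr1 -%R) := subrX1 q m.+1; rewrite -mulNr !opprB => h.
by rewrite mulrCA -h; ring.
Qed.

(** The identity between the two generating functions, with [P 0] as [O] and [S 0] as [E]. Since
    [q^(n+1) = 0], index [n] plays the role of infinity. *)
Lemma key_identity (R : comNzRingType) (q : R) (v P S : nat -> R) (n : nat) :
  (forall k, v k * (1 - q ^+ k.*2.+1) = 1) ->
  (forall j, P j.+1 * (1 - q ^+ j.+1.*2) = P j * (1 - q ^+ j.*2.+1)) ->
  (forall j, S j.+1 * (1 - q ^+ j.+1.*2.+1) = S j * (1 - q ^+ j.+1.*2)) ->
  q ^+ n.+1 = 0 -> P n = S 0 -> S n = P 0 * (1 - q) ->
  P 0 * (1 - q) + \sum_(1 <= j < n.+1) P j * q ^+ j.*2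
  = \sum_(1 <= j < n.+1) S j * q ^+ j.*2.+1 + S 0
    + \sum_(2 <= t < n.+1.*2) \sum_(2 <= i < t.+1) S 0 * q ^+ ('C(t.+1, 2) + i).
Proof.
move=> hv hP hS q0 hPn hSn; have qge := expr_ge_eq0 q0.
(* [v 0] is an inverse of [1 - q], so both sides may be compared after multiplication by [1 - q]. *)
have cancel x y : x * (1 - q) = y * (1 - q) -> x = y.
  move=> /(congr1 ( *%R^~ (v 0))); rewrite -!mulrA [_ * v 0]mulrC.
  by have := hv 0; rewrite double0 expr1 => ->; rewrite !mulr1.
have sumP J : (\sum_(0 <= j < J.+1) P j * q ^+ j.*2) * (1 - q)
            = P J * (1 - q ^+ J.*2.+1).
  elim: J => [|J IH]; first by rewrite big_nat1 expr0 mulr1 expr1.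
  by rewrite big_nat_recr //= mulrDl IH -hP [q ^+ J.+1.*2.+1]exprS; ring.
have sumS J : (\sum_(1 <= j < J.+1) S j * q ^+ j.*2.+1) * (1 - q)
            = S J * (1 - q ^+ J.+1.*2) - S 0 * (1 - q ^+ 2).
  elim: J => [|J IH]; first by rewrite big_geq // mul0r subrr.
  rewrite big_nat_recr //= mulrDl IH -hS [J.+2.*2]doubleS !(exprS q J.+1.*2).
  by rewrite (exprS q J.+1.*2.+1) (exprS q J.+1.*2); ring.
(* Gauss's identity: in Shanks's sum every term with [s > 0] has exponent at least [2n+1] and
   vanishes. *)
have psi : P 0 = S 0 * \sum_(0 <= t < n.+1.*2) q ^+ 'C(t.+1, 2).
  rewrite (ratio_prod n hv hP) hPn; congr (_ * _).
  rewrite doubleS big_nat_recr //= (qge 'C(_, _)); last first.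
    by rewrite -doubleS bin2_double; nia.
  rewrite addr0 -(shanks n hv) [in RHS]big_ltn // mul0n mulr1.
  rewrite [X in _ + X]big_nat [X in _ + X]big1 ?addr0 // => s /andP[s0 _].
  by rewrite qge ?mulr0 //; nia.
have := sumP n; rewrite big_ltn // expr0 mulr1 qge ?subr0 ?mulr1; last by lia.
have := sumS n; rewrite qge ?subr0 ?mulr1; last by lia.
set SS := \sum_(1 <= j < n.+1) _; set PP := \sum_(1 <= j < n.+1) _.
move=> eqS eqP; apply: cancel.
set Z := \sum_(2 <= t < _) _.
(* The first two exponents of each block give [(1 + q) * P 0] and the others give [Z]. Block 0 has a
   single exponent, whence the correction [- q * S 0]. *)
have blocks : (1 - q) * ((1 + q) * P 0 - q * S 0 + Z) = S 0.
  have := sum_triangular_blocks q n.+1.*2; rewrite (qge 'C(_, _)); last first.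
    by rewrite bin2_doubleS; nia.
  rewrite subr0 doubleS big_ltn // big_ltn // big_nat1.
  rewrite [\sum_(0 <= i < 2) _]big_ltn // big_nat1.
  have -> : \sum_(2 <= t < n.*2.+2) \sum_(0 <= i < t.+1) q ^+ ('C(t.+1, 2) + i)
    = (1 + q) * \sum_(2 <= t < n.*2.+2) q ^+ 'C(t.+1, 2)
      + \sum_(2 <= t < n.*2.+2) \sum_(2 <= i < t.+1) q ^+ ('C(t.+1, 2) + i).
    rewrite mulr_sumr -big_split /=; apply: eq_big_nat => t /andP[t2 _].
    rewrite big_ltn // big_ltn; last by rewrite ltnS ltnW.
    by rewrite addn0 addn1 exprS addrA mulrDl mul1r.
  have -> : Z = S 0 * \sum_(2 <= t < n.*2.+2) \sum_(2 <= i < t.+1) q ^+ ('C(t.+1, 2) + i).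
    by rewrite mulr_sumr; apply: eq_bigr => t _; rewrite mulr_sumr.
  rewrite psi doubleS [in X in _ -> X]big_ltn // [in X in _ -> X]big_ltn //.
  set Y := \sum_(2 <= t < _) q ^+ _; set W := \sum_(2 <= t < _) _.
  rewrite (_ : 'C(1, 2) = 0)%N // (_ : 'C(2, 2) = 1)%N // => eq1.
  by have := congr1 ( *%R (S 0)) eq1; rewrite mulr1 => h; rewrite -[in RHS]h; ring.
have -> : (P 0 * (1 - q) + PP) * (1 - q) = (P 0 + PP) * (1 - q) - P 0 * (1 - q) * q by ring.
(* Expanding the leading [S 0] by [blocks] turns both sides into [(1 - q) * (P 0 - q * S 0 + Z)]. *)
rewrite eqP hPn ![in RHS]mulrDl eqS hSn -[X in X - _]blocks; ring.
Qed.

(** * Generating functions and extraction of coefficients *)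

(* Power series in [q] truncated above degree [n]. *)
Local Notation qseries n := {poly %/ ('X^(n.+1) : {poly int})}.

Definition qvar (n : nat) : qseries n := in_qpoly _ 'X.

Definition parts_series (n : nat) (L : pred nat) : qseries n :=
  in_qpoly _ (\poly_(i < n.+1) (parts_in i L)%:R).

Lemma qseriesP (n : nat) (x y : qseries n) :
  (forall i, (i <= n)%N -> (x : {poly int})`_i = (y : {poly int})`_i) -> x = y.
Proof.
move=> eqxy; apply/val_inj/polyP => i; case: (leqP i n) => [/eqxy //|lt_ni].
by rewrite !big_coef_npoly // mk_monic_Xn size_polyXn.
Qed.

Lemma coef_in_qpoly (n i : nat) (p : {poly int}) : (i <= n)%N ->
  (in_qpoly 'X^(n.+1) p : {poly int})`_i = p`_i.
Proof.
move=> le_in; rewrite /= mk_monic_Xn -Pdiv.RingMonic.take_poly_rmodp.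
by rewrite coef_take_poly ltnS le_in.
Qed.

Lemma coef_qseriesMXn (n k : nat) (x : qseries n) (i : nat) : (i <= n)%N ->
  (x * qvar n ^+ k : {poly int})`_i = if (k <= i)%N then (x : {poly int})`_(i - k) else 0.
Proof.
move=> le_in; have -> : x = in_qpoly 'X^(n.+1) (x : {poly int}).
  by apply/qseriesP => j le_jn; rewrite coef_in_qpoly.
rewrite -rmorphXn -rmorphM coef_in_qpoly // coefMXn ltnNge if_neg.
by case: ifP => // le_ki; rewrite coef_in_qpoly // (leq_trans (leq_subr _ _)).
Qed.

Lemma qvar_nilpotent (n : nat) : qvar n ^+ n.+1 = 0.
Proof.
apply/qseriesP => i le_in; rewrite -[qvar n ^+ _]mul1r coef_qseriesMXn //.
by rewrite leqNgt ltnS le_in coef0.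
Qed.

Lemma coef_parts_series (n i : nat) (L : pred nat) : (i <= n)%N ->
  (parts_series n L : {poly int})`_i = (parts_in i L)%:R.
Proof. by move=> le_in; rewrite coef_in_qpoly // coef_poly ltnS le_in. Qed.

Lemma coef_parts_seriesMXn (n k : nat) (L : pred nat) :
  (parts_series n L * qvar n ^+ k : {poly int})`_n
  = (if k <= n then parts_in (n - k) L else 0)%N%:R.
Proof.
rewrite coef_qseriesMXn //; case: ifP => // le_kn.
by rewrite coef_parts_series ?leq_subr.
Qed.

Lemma eq_parts_series (n : nat) (L M : pred nat) :
  (forall x, (0 < x <= n)%N -> L x = M x) -> parts_series n L = parts_series n M.
Proof.
move=> eqLM; apply/qseriesP => i le_in; rewrite !coef_parts_series //.
congr (_ %:R); apply: eq_parts_in => x /andP[x0 le_xi].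
by rewrite eqLM // x0 (leq_trans le_xi).
Qed.

Lemma parts_seriesD1 (n a : nat) (L : pred nat) : (0 < a)%N -> L a ->
  parts_series n L * (1 - qvar n ^+ a) = parts_series n (fun x => (x != a) && L x).
Proof.
move=> a0 La; rewrite mulrBr mulr1; apply/eqP; rewrite subr_eq; apply/eqP.
apply/qseriesP => i le_in; rewrite poly_of_qpolyD coefD coef_qseriesMXn //.
rewrite !coef_parts_series ?(leq_trans (leq_subr _ _)) //.
by rewrite (parts_inD1 _ a0 La) natrD addrC; case: ifP.
Qed.

Lemma parts_series_pred0 (n : nat) (L : pred nat) :
  (forall x, (0 < x <= n)%N -> L x = false) -> parts_series n L = 1.
Proof.
move=> L0; apply/qseriesP => i le_in; rewrite coef_parts_series // parts_in_pred0.
  by rewrite -in_qpoly1 coef_in_qpoly // coef1.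
by move=> x /andP[x0 le_xi]; rewrite L0 // x0 (leq_trans le_xi).
Qed.

(** The coefficient of [q^n] in [key_identity], read in series truncated above degree [n]. *)
Lemma q_eu_ou_excess (n : nat) :
  (q_eu_ou n = q_ou_eu n + parts_in n (odds_le_evens_gt 0)
    + \sum_(2 <= t < n.+1.*2) \sum_(2 <= i < t.+1)
        if 'C(t.+1, 2) + i <= n
        then parts_in (n - ('C(t.+1, 2) + i)) (odds_le_evens_gt 0) else 0)%N.
Proof.
pose P j := parts_series n (evens_le_odds_gt j).
pose S j := parts_series n (odds_le_evens_gt j).
(* Partitions into copies of the single part [2k+1] give the geometric series [1/(1 - q^(2k+1))]. *)
pose v k := parts_series n (pred1 k.*2.+1).
have hv k : v k * (1 - qvar n ^+ k.*2.+1) = 1.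
  rewrite parts_seriesD1 //= ?eqxx // parts_series_pred0 // => x _.
  by rewrite andNb.
have hP j : P j.+1 * (1 - qvar n ^+ j.+1.*2) = P j * (1 - qvar n ^+ j.*2.+1).
  (* Both sides become the series for even parts at most [2j] and odd parts above [2j+1]. *)
  rewrite !parts_seriesD1 //; try by rewrite /evens_le_odds_gt /= odd_double /=.
  by apply: eq_parts_series => x _ /=; rewrite /evens_le_odds_gt; case: ifP; lia.
have hS j : S j.+1 * (1 - qvar n ^+ j.+1.*2.+1) = S j * (1 - qvar n ^+ j.+1.*2).
  rewrite !parts_seriesD1 //; try by rewrite /odds_le_evens_gt /= odd_double /=.
  by apply: eq_parts_series => x _ /=; rewrite /odds_le_evens_gt; case: ifP; lia.
(* Among parts at most [n], the bound [2n] admits every even part and no odd one. *)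
have hPn : P n = S 0%N.
  apply: eq_parts_series => x; rewrite /evens_le_odds_gt /odds_le_evens_gt; case: ifP; lia.
have P0 : P 0%N * (1 - qvar n) = parts_series n (fun x => odd x && (1 < x)%N).
  rewrite -[qvar n]expr1 parts_seriesD1 //; apply: eq_parts_series => x /=.
  rewrite /evens_le_odds_gt; case: ifP; lia.
have hSn : S n = P 0%N * (1 - qvar n).
  rewrite P0; apply: eq_parts_series => x; rewrite /odds_le_evens_gt; case: ifP; lia.
have := key_identity hv hP hS (qvar_nilpotent n) hPn hSn.
move=> /(congr1 (fun x : qseries n => (x : {poly int})`_n)).
rewrite P0 /P /S !poly_of_qpolyD !coefD !poly_of_qpoly_sum !coef_sum !coef_parts_series //.
under [X in _ + X = _ -> _]eq_bigr do rewrite coef_parts_seriesMXn.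
under [X in _ = X + _ + _ -> _]eq_bigr do rewrite coef_parts_seriesMXn.
under [X in _ = _ + X -> _]eq_bigr => t _.
  rewrite poly_of_qpoly_sum coef_sum.
  under eq_bigr do rewrite coef_parts_seriesMXn.
  rewrite -natr_sum.
over.
rewrite -!natr_sum -!natrD -q_eu_ou_sum -q_ou_eu_sum => /eqP.
by rewrite eqr_nat => /eqP.
Qed.

(** * Positivity of the excess *)

Lemma parts_in_even_gt0 (m : nat) : (0 < parts_in m.*2 (odds_le_evens_gt 0))%N.
Proof.
have Pm : is_partition m.*2 (nseq m 2).
  apply/and3P; split.
  - by case: m => //= m; elim: m.
  - by rewrite mem_nseq andbF.
  - by rewrite sumn_nseq mul2n.
apply/card_gt0P; exists (IntPart Pm); rewrite inE /=; apply/allP => x.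
by move=> /nseqP[->].
Qed.

Local Close Scope ring_scope.

Theorem theorem4p2 (n : nat) (hn : 3 < n) : q_ou_eu n < q_eu_ou n.
Proof.
rewrite q_eu_ou_excess -addnA -addn1 leq_add2l.
(* For even [n] the term 1 of the bracket contributes the partitions of [n] into even parts. *)
case: (boolP (odd n)) => [odd_n|even_n]; last first.
  by rewrite ltn_addr // -(even_halfK even_n) parts_in_even_gt0.
(* For odd [n], hence [n >= 5], the term [t = i = 2] has exponent [3 + 2 = 5] and leaves the even
   number [n - 5]. *)
apply: ltn_addl; rewrite doubleS big_ltn; last by lia.
rewrite big_nat1 ifT; last by rewrite (_ : 'C(3, 2) = 3) //; lia.
rewrite ltn_addr // (_ : 'C(3, 2) = 3) //.
have -> : (n - (3 + 2) = (n - 5)./2.*2) by lia.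
exact: parts_in_even_gt0.
Qed.
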